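(* Let $P$ be an infinite set of primes and let $k\in\mathbb{N}=\{1,2,\dots\}$. Let $(p_n)_{n\ge 1}$ be the strictly increasing sequence with underlying set $P$, and let $M_{P,k}$ be the additive submonoid of $\mathbb{Q}_{\ge 0}$ generated by the set \[ \Big\{ \frac{1}{p_j p_{j+2}\cdots p_{j+2k}} : j\in\mathbb{N}\Big\}. \] Then $M_{P,k}$ is an MCD-finite monoid.
   Context: For an additive submonoid $M$ of $\mathbb{Q}_{\ge 0}$ and $a,b\in M$, write $b\mid_M a$ ($b$ divides $a$) if $a-b\in M$. For a nonempty finite subset $S$ of $M$, a common divisor $d\in M$ of $S$ (i.e. $d\mid_M s$ for all $s\in S$) is a maximal common divisor (MCD) of $S$ if the only common divisor of $\{s-d : s\in S\}$ in $M$ is $0$ (the only unit of $M$). $M$ is MCD-finite if every nonempty finite subset of $M$ has only finitely many MCDs (up to associates, which here means up to equality since $0$ is the only unit). The generator $\frac{1}{p_j p_{j+2}\cdots p_{j+2k}}$ has denominator $\prod_{i=0}^{k} p_{j+2i}$. *)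

(* Defs.v *)
From mathcomp Require Import all_boot all_order all_algebra.
From mathcomp Require Import boolp classical_sets functions cardinality.

Set Implicit Arguments.
Unset Strict Implicit.
Unset Printing Implicit Defensive.

Import Order.TTheory GRing.Theory Num.Theory.

Local Open Scope classical_set_scope.
Local Open Scope ring_scope.

(** Additive submonoids of the nonnegative rationals, as sets of rationals. *)
Definition submonoid (M : set rat) : Prop :=
  [/\ M `<=` [set x | 0 <= x], M 0 & forall x y, M x -> M y -> M (x + y)].

(** Meaningful for [G] consisting of nonnegative rationals; otherwise no
    submonoid contains [G] and this is the whole of [rat]. *)
Definition generated_submonoid (G : set rat) : set rat := smallest submonoid G.

Definition divides (M : set rat) (b a : rat) : Prop := M (a - b).

Definition common_divisor (M S : set rat) (d : rat) : Prop :=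
  M d /\ forall s, S s -> divides M d s.

Definition is_mcd (M S : set rat) (d : rat) : Prop :=
  common_divisor M S d /\
  [set e | common_divisor M [set s - d | s in S] e] = [set 0].

(** The only unit of a submonoid of the nonnegative rationals is [0], so
    finiteness up to associates is plain finiteness. *)
Definition mcd_finite (M : set rat) : Prop :=
  forall S : set rat, finite_set S -> S !=set0 -> S `<=` M ->
    finite_set [set d | is_mcd M S d].

(** [p] is used at indices [n >= 1] only; [p 0] is irrelevant. *)
Definition increasing_enumeration (P : set nat) (p : nat -> nat) : Prop :=
  (forall m n : nat, (0 < m)%N -> (m < n)%N -> (p m < p n)%N) /\
  [set p n | n in [set n : nat | (0 < n)%N]] = P.

Definition generator (p : nat -> nat) (k j : nat) : rat :=
  (\prod_(0 <= i < k.+1) p (j + 2 * i)%N)%N%:R^-1.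

(** The monoid M_{P,k}, where [p] is the increasing enumeration of [P]. *)
Definition M_ (p : nat -> nat) (k : nat) : set rat :=
  generated_submonoid [set generator p k j | j in [set j : nat | (0 < j)%N]].

Lemma M_submonoid (p : nat -> nat) (k : nat) : submonoid (M_ p k).
Proof.
have nnegP : submonoid [set x : rat | 0 <= x].
  by split=> //= x y; exact: addr_ge0.
split=> [x Mx | N [[_ N0 _] _] // | x y Mx My N NP].
- by apply: Mx; split=> // _ [j _ <-] /=; rewrite /generator invr_ge0 ler0n.
- by case: (NP) => -[_ _ ND] _; apply: ND; [exact: Mx | exact: My].
Qed.

(* Main.v *)
Require Import Defs.
From mathcomp Require Import all_boot all_order all_algebra.
From mathcomp Require Import boolp classical_sets functions cardinality.

(** Write [g_j] for the [j]-th generator. The prime [p_(j+2k)] divides the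
    denominator of [g_j] but of no earlier generator, and
    [p_(j+2+2k) g_(j+2) = p_j g_j]. Hence, if no prime [p_i] with [i > L + 2k]
    occurs in the denominator of an element of the monoid, its factorization
    can be rewritten to involve only [g_1, ..., g_L].
    Let [d] be a maximal common divisor of [S], and suppose that the last prime
    occurring in the denominator of [d] is [p_(L+2k)], beyond all the primes
    occurring in [S]. Then it is also the last one occurring in each [s - d],
    so [g_L] divides every [s - d], contradicting maximality. So [d] is a
    combination of boundedly many generators, and it is bounded by any element
    of [S]. *)

Local Open Scope classical_set_scope.

Set Implicit Arguments.
Unset Strict Implicit.
Unset Printing Implicit Defensive.
Import Order.TTheory GRing.Theory Num.Theory.
Local Open Scope ring_scope.

(** [x] lies in the localization of the integers at the prime [q]. *)
Definition integral_at (q : nat) (x : rat) : Prop :=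
  exists2 n : nat, ~~ (q %| n)%N & x * n%:R \is a Num.int.

(** * Localization of the integers at a prime *)

Section IntegralAt.
Variables (q : nat) (q_pr : prime q).

Lemma integral_at0 : integral_at q 0.
Proof.
by exists 1%N; rewrite ?mul0r ?rpred0 // dvdn1; case: eqP q_pr => // ->.
Qed.

Lemma integral_atD x y :
  integral_at q x -> integral_at q y -> integral_at q (x + y).
Proof.
move=> [m qm xm] [n qn yn]; exists (m * n)%N.
  by rewrite Euclid_dvdM // negb_or qm.
rewrite natrM mulrDl mulrA [m%:R * _]mulrC [y * _]mulrA.
by rewrite rpredD // rpredM // rpred_nat.
Qed.

Lemma integral_atN x : integral_at q x -> integral_at q (- x).
Proof. by move=> [n qn xn]; exists n => //; rewrite mulNr rpredN. Qed.

Lemma integral_atB x y :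
  integral_at q x -> integral_at q y -> integral_at q (x - y).
Proof. by move=> qx qy; apply/integral_atD/integral_atN. Qed.

Lemma integral_atMn x n : integral_at q x -> integral_at q (x *+ n).
Proof.
by move=> [m qm xm]; exists m => //; rewrite mulrnAl rpredMn.
Qed.

Lemma integral_at_inv n : ~~ (q %| n)%N -> integral_at q n%:R^-1.
Proof.
move=> qn; exists n => //; rewrite mulVf ?rpred1 // pnatr_eq0.
by apply: contraNneq qn => ->; rewrite dvdn0.
Qed.

(** Clearing the denominator [m] of [c / n] gives [c * m = z * n], so [q] divides [c * m] but not
    [m]. *)
Lemma integral_at_invMn n c : (0 < n)%N -> (q %| n)%N ->
  integral_at q (n%:R^-1 *+ c) -> (q %| c)%N.
Proof.
move=> n_gt0 qn [m qm /intrP[z cmz]].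
have n0 : (n%:R : rat) != 0 by rewrite pnatr_eq0 -lt0n.
have cm : (c * m)%:Z = z * n%:Z.
  apply: (@intr_inj rat); rewrite !intrM -cmz.
  by rewrite -!pmulrn -[_^-1 *+ c]mulr_natl -!mulrA [m%:R * _]mulrC mulKf // natrM.
have : (n %| c * m)%N by rewrite -[(n %| _)%N]/(n%:Z %| (c * m)%:Z)%Z cm dvdz_mull.
by move=> /(dvdn_trans qn); rewrite Euclid_dvdM // (negPf qm) orbF.
Qed.

End IntegralAt.

(** * Generators and their denominators *)

Section Monoid.
Variables (p : nat -> nat) (k : nat).
Hypothesis p_prime : forall i, (0 < i)%N -> prime (p i).
Hypothesis p_inj : forall i j, (0 < i)%N -> (i < j)%N -> p i <> p j.

Local Notation g := (generator p k).
Local Notation M := (M_ p k).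

Lemma generator_den_gt0 j : (0 < j)%N ->
  (0 < \prod_(0 <= i < k.+1) p (j + 2 * i))%N.
Proof.
move=> j0; rewrite prodn_cond_gt0 // => i _.
by rewrite prime_gt0 // p_prime // addn_gt0 j0.
Qed.

Lemma generator_gt0 j : (0 < j)%N -> 0 < g j.
Proof. by move=> j0; rewrite invr_gt0 ltr0n generator_den_gt0. Qed.

Lemma generator_integral_at j m : (0 < j)%N -> (j + 2 * k < m)%N ->
  integral_at (p m) (g j).
Proof.
move=> j0 jm; have m0 : (0 < m)%N by apply: leq_ltn_trans jm.
apply: integral_at_inv; rewrite big_mkord Euclid_dvd_prod ?p_prime // big_orE.
apply/existsP => -[i /= pmi].
have ji0 : (0 < j + 2 * i)%N by rewrite addn_gt0 j0.
move: pmi; rewrite dvdn_prime2 ?p_prime // => /eqP/esym; apply: p_inj => //.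
by apply: leq_ltn_trans jm; rewrite leq_add2l leq_mul2l /= -ltnS.
Qed.

Lemma generatorMn_integral_at j c : (0 < j)%N ->
  integral_at (p (j + 2 * k)) (g j *+ c) -> (p (j + 2 * k) %| c)%N.
Proof.
move=> j0; apply: integral_at_invMn; rewrite ?generator_den_gt0 //.
  by rewrite p_prime // addn_gt0 j0.
by rewrite big_nat_recr //= dvdn_mull.
Qed.

(** The denominators of [g j] and [g j.+2] agree except for the first factor of one and the last
    factor of the other. *)
Lemma generator_shift j : (0 < j)%N ->
  g j.+2 *+ p (j.+2 + 2 * k) = g j *+ p j.
Proof.
move=> j0; have pj0 i : (0 < i)%N -> (p i)%:R != 0 :> rat.
  by move=> i0; rewrite pnatr_eq0 -lt0n prime_gt0 // p_prime.
have e : (\prod_(0 <= i < k.+1) p (j + 2 * i) * p (j.+2 + 2 * k)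
        = p j * \prod_(0 <= i < k.+1) p (j.+2 + 2 * i))%N.
  have -> : (j.+2 + 2 * k = j + 2 * k.+1)%N by rewrite mulnS addnA addn2.
  rewrite -(big_nat_recr k.+1 0 (fun i => p (j + 2 * i)%N)) //=.
  rewrite big_nat_recl // muln0 addn0; congr muln.
  by apply: eq_bigr => i _; rewrite mulnS addnA addn2.
have d0 i : (0 < i)%N -> (\prod_(0 <= l < k.+1) p (i + 2 * l))%N%:R != 0 :> rat.
  by move=> i0; rewrite pnatr_eq0 -lt0n generator_den_gt0.
rewrite /generator -[LHS]mulr_natl -[RHS]mulr_natl; apply/eqP; rewrite eqr_div ?d0 //.
by rewrite -!natrM eqr_nat mulnC e.
Qed.

(** * Combinations of the first generators *)

Fixpoint span (L : nat) : set rat :=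
  if L is L'.+1 then [set x + g L *+ c | x in span L' & c in [set: nat]]
  else [set 0].

Lemma span_monoid L : span L `<=` M.
Proof.
have [_ M0 MD] := M_submonoid p k.
elim: L => [|L IH] x; first by move=> ->.
move=> [y /IH My [c _ <-]]; apply: (MD) => //.
elim: c => [|c IHc]; first by rewrite mulr0n.
by rewrite mulrS; apply: MD => // N [_]; apply; exists L.+1.
Qed.

Lemma span0 L : span L 0.
Proof.
by elim: L => //= L IH; exists 0 => //; exists 0%N => //; rewrite addr0.
Qed.

Lemma span_le L L' : (L <= L')%N -> span L `<=` span L'.
Proof.
move=> /subnKC <-; elim: (L' - L)%N => [|m IH] x; rewrite ?addn0 // => /IH xm.
by rewrite addnS; exists x => //; exists 0%N => //; rewrite addr0.
Qed.

Lemma spanD L x y : span L x -> span L y -> span L (x + y).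
Proof.
elim: L x y => [|L IH] x y /=; first by move=> -> ->; rewrite addr0.
move=> [x' sx [c _ <-]] [y' sy [c' _ <-]]; exists (x' + y'); first exact: IH.
by exists (c + c')%N => //; rewrite mulrnDr addrACA.
Qed.

Lemma span_generatorMn j L c : (0 < j <= L)%N -> span L (g j *+ c).
Proof.
case: j => // j jL; apply: (span_le jL).
by exists 0; [exact: span0 | exists c; rewrite // add0r].
Qed.

(** The spans form a chain, so their union is a submonoid; it contains all generators. *)
Lemma monoid_span x : M x -> exists L, span L x.
Proof.
move=> /(_ [set x | exists L, span L x]); apply; split.
  split; last 1 first.
  - move=> y z [L sy] [L' sz]; exists (maxn L L').
    by apply: spanD; [apply: span_le sy | apply: span_le sz];
      rewrite ?leq_maxl ?leq_maxr.
  - by move=> y [L /span_monoid]; have [+ _ _] := M_submonoid p k; apply.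
  - by exists 0%N.
move=> _ [j /= j0 <-]; exists j; rewrite -[g j]mulr1n.
by apply: span_generatorMn; rewrite j0 /=.
Qed.

Lemma span_integral_at L m x : (0 < m)%N -> (L + 2 * k < m)%N ->
  span L x -> integral_at (p m) x.
Proof.
move=> m0; elim: L x => [|L IH] x Lm /=.
  by move=> ->; apply/integral_at0/p_prime.
move=> [y sy [c _ <-]]; apply: integral_atD; first exact: p_prime.
  by apply: IH => //; apply: ltnW.
by apply/integral_atMn/generator_integral_at.
Qed.

(** Descent on the index [J.+1] of the last generator: its coefficient is divisible by
    [p (J.+1 + 2 * k)], so [generator_shift] trades it for a multiple of the generator two places
    earlier. *)
Lemma span_reduce L x : (1 < L)%N -> M x ->
  (forall m, (L + 2 * k < m)%N -> integral_at (p m) x) -> span L x.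
Proof.
move=> L1 /monoid_span[J sx] px; elim: J sx => [/span_le|J IH sx]; first exact.
have [JL|LJ] := leqP J.+1 L; first exact: span_le sx.
apply: IH; case: sx => y sy [c _ yx].
have /dvdnP[c' cE] : (p (J.+1 + 2 * k) %| c)%N.
  apply: generatorMn_integral_at => //.
  (* The last term is [x - y], and both [x] and [y] are integral at this prime. *)
  rewrite -[X in integral_at _ X](addKr y) yx addrC.
  apply: integral_atB; first by rewrite p_prime // addn_gt0.
    by apply: px; rewrite ltn_add2r.
  by apply: span_integral_at sy; rewrite ?addSn ?ltnS.
(* From [1 < L] the index [J.+1] is at least 3, so the earlier generator has a positive index. *)
case: J => [|[|J]] in LJ sy yx cE *;
  [by have := leq_ltn_trans L1 LJ | by have := leq_ltn_trans L1 LJ |].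
rewrite -yx cE mulnC mulrnA generator_shift // -mulrnA.
by apply: spanD => //; apply: span_generatorMn; rewrite leqnSn.
Qed.

(** A zero last coefficient would make [x] integral at this prime; hence one copy of [g L.+1] can be
    removed. *)
Lemma span_generator_divides L x : span L.+1 x ->
  ~ integral_at (p (L.+1 + 2 * k)) x -> divides M (g L.+1) x.
Proof.
move=> [y sy [[|c] _ <-]] px.
  by exfalso; apply: px; rewrite addr0; apply: span_integral_at sy; rewrite ?addSn.
apply: (@span_monoid L.+1); rewrite mulrSr addrA addrK.
by exists y => //; exists c.
Qed.

(** All terms are nonnegative, so each partial sum is at most [b] and each coefficient is at most
    [b] over its generator. *)
Lemma finite_set_span_le L b : finite_set [set x | span L x /\ x <= b].
Proof.
elim: L => [|L IH]; first by apply: sub_finite_set (finite_set1 0) => x [].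
apply: (sub_finite_set _ (finite_image2 (fun x c => x + g L.+1 *+ c)
  IH (finite_II (Num.bound (b / g L.+1))))).
move=> _ [[y sy [c _ <-]] yb] /=.
have gL : 0 < g L.+1 by apply: generator_gt0.
have y0 : 0 <= y by have [+ _ _] := M_submonoid p k; apply; apply: span_monoid sy.
have c0 : 0 <= g L.+1 *+ c by rewrite mulrn_wge0 // ltW.
exists y; first by split=> //; apply: le_trans yb; rewrite lerDl.
exists c => //=; rewrite -(ltr_nat rat).
have cb : c%:R <= b / g L.+1.
  by rewrite ler_pdivlMr // mulr_natl; apply: le_trans yb; rewrite lerDr.
exact: le_lt_trans cb (archi_boundP (le_trans (ler0n _ _) cb)).
Qed.

Lemma finite_set_sub_span (S : set rat) : finite_set S -> S `<=` M ->
  exists L, S `<=` span L.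
Proof.
move=> /finite_seqP[s ->]; elim: s => [|a s IH] sM; first by exists 0%N => x /=.
have [|L sL] := IH.
  by move=> x xs; apply: sM; rewrite /= inE [x \in s]xs orbT.
have [|L' aL] := @monoid_span a; first by apply: sM; rewrite /= mem_head.
exists (maxn L L') => x /=; rewrite inE => /orP[/eqP->|xs].
  by apply: span_le aL; rewrite leq_maxr.
by apply: span_le (sL x xs); rewrite leq_maxl.
Qed.

(** * Maximal common divisors *)

Lemma mcd_span (S : set rat) L d : (1 < L)%N -> S !=set0 -> S `<=` span L ->
  is_mcd M S d -> span L d.
Proof.
move=> L1 [s0 Ss0] SL [[Md dS] dmax]; have [J sd] := monoid_span Md.
elim: J sd => [/span_le|J IH sd]; first exact.
have [JL|LJ] := leqP J.+1 L; first exact: span_le sd.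
have [pd|pd] := pselect (integral_at (p (J.+1 + 2 * k)) d).
  apply/IH/span_reduce => //; first exact: (leq_trans L1 LJ).
  move=> m; rewrite -addSn leq_eqVlt => /orP[/eqP<- //|Jm].
  by apply: span_integral_at sd => //; apply: leq_ltn_trans Jm.
have gdvd : common_divisor M [set s - d | s in S] (g J.+1).
  split.
    apply: (@span_monoid J.+1); rewrite -[g _]mulr1n.
    by apply: span_generatorMn; rewrite leqnn.
  move=> _ [s Ss <-].
  have sint m : (L + 2 * k < m)%N -> integral_at (p m) s.
    by move=> Lm; apply: span_integral_at (SL _ Ss) => //; apply: leq_ltn_trans Lm.
  apply: span_generator_divides.
    apply: span_reduce; [exact: leq_trans L1 (ltnW LJ) | exact: dS |].
    move=> m Jm; have m0 : (0 < m)%N by apply: leq_ltn_trans Jm.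
    apply: integral_atB; first exact: p_prime.
      by apply: sint; apply: leq_trans Jm; rewrite ltnS leq_add2r ltnW.
    exact: span_integral_at sd.
  (* Since [s] is integral at this prime, integrality of [s - d] would pass to [d]. *)
  move=> psd; apply: pd; rewrite -(subKr s d); apply: integral_atB => //.
    by rewrite p_prime // addn_gt0.
  by apply: sint; rewrite ltn_add2r.
have g0 : [set 0] (g J.+1) by rewrite -dmax.
by have := @generator_gt0 J.+1 isT; rewrite g0 ltxx.
Qed.

Lemma monoid_mcd_finite : mcd_finite M.
Proof.
move=> S finS S0 SM; have [L SL] := finite_set_sub_span finS SM.
have [s Ss] := S0.
(* The maximum with 2 secures the bound [1 < L] of [mcd_span]. *)
apply: sub_finite_set (finite_set_span_le (maxn 2 L) s) => d dmcd /=; split.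
  apply: mcd_span dmcd => //; first by rewrite leq_max.
  by move=> x /SL; apply: span_le; rewrite leq_maxr.
have [[_ /(_ s Ss) Msd] _] := dmcd; rewrite -subr_ge0.
by have [+ _ _] := M_submonoid p k; apply.
Qed.

End Monoid.

Theorem proposition4p1 (P : set nat) (Pprime : P `<=` [set q : nat | prime q])
  (Pinf : infinite_set P) (k : nat) (k1 : (1 <= k)%N)
  (p : nat -> nat) (pP : increasing_enumeration P p) :
  mcd_finite (M_ p k).
Proof.
have [p_incr pE] := pP; apply: monoid_mcd_finite => [i i0|i j i0 /(p_incr _ _ i0)].
  by apply: Pprime; rewrite -pE; exists i.
by move=> /[swap] ->; rewrite ltnn.
Qed.
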